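(* Let $x,z\in\mathbb{R}$ and let $P=(x,z/2)$. Let $R_1$ be the Euclidean distance from $P$ to $(0,1/2)$ and $R_2$ the Euclidean distance from $P$ to $(0,-1/2)$. Then the four roots (with multiplicity) of the quartic polynomial $$p_{x,z}(u)=u^4-(z^2+4x^2+1)u^2+z^2$$ are $R_1+R_2$, $R_1-R_2$, $-(R_1+R_2)$ and $-(R_1-R_2)$. *)

(* Defs.v *)
From HB Require Import structures.
From mathcomp Require Import all_boot all_order all_algebra.
From mathcomp Require Import reals complex.

Set Implicit Arguments.
Unset Strict Implicit.
Unset Printing Implicit Defensive.

Import Order.TTheory GRing.Theory Num.Theory.
Local Open Scope ring_scope.
Local Open Scope complex_scope.

Definition eucl_dist (R : realType) (P Q : R * R) : R :=
  Num.sqrt ((P.1 - Q.1) ^+ 2 + (P.2 - Q.2) ^+ 2).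

Definition quartic (R : realType) (x z : R) : {poly R} :=
  'X^4 - (z ^+ 2 + 4 * x ^+ 2 + 1) *: 'X^2 + (z ^+ 2)%:P.

(* Roots are taken in the complex numbers, so that a real list satisfying
   this predicate leaves out no root of p. The order of rs is irrelevant;
   mup is only meaningful for p != 0. *)
Definition roots_with_mult (R : realType) (p : {poly R}) (rs : seq R) : Prop :=
  forall c : R[i],
    mup c (map_poly (real_complex R) p)
    = count_mem c [seq real_complex R r | r <- rs].

(* Main.v *)
(* With a = R1 + R2 and b = R1 - R2, the parallelogram law gives
   a^2 + b^2 = 2 (R1^2 + R2^2) = z^2 + 4 x^2 + 1, while a b = R1^2 - R2^2 = - z;
   hence the quartic is (u^2 - a^2) (u^2 - b^2). *)
Require Import Defs.
From mathcomp Require Import all_boot all_order all_algebra.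
From mathcomp Require Import reals complex.
From mathcomp Require Import ring.

Import Order.TTheory GRing.Theory Num.Theory.
Local Open Scope ring_scope.

(** In a product of linear factors, multiplicities just count factors ([mup_prod_XsubC]), and such a
    product stays split under the embedding of the reals into the complex numbers. So it suffices to
    factor the quartic over the reals, which [prod_XsubC_biquadratic] reduces to computing a^2 + b^2
    and a b. *)

Lemma mup_prod_XsubC (F : fieldType) (s : seq F) (c : F) :
  mup c (\prod_(r <- s) ('X - r%:P)) = count_mem c s.
Proof.
elim: s => [|r s IHs]; first by rewrite big_nil mupNroot // rootC oner_eq0.
rewrite big_cons mupM ?polyXsubC_eq0 ?monic_neq0 ?monic_prod_XsubC //.
by rewrite IHs -['X - r%:P]expr1 mup_XsubCX /=; case: (r == c).
Qed.

Lemma roots_with_mult_prod_XsubC (R : realType) (s : seq R) :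
  roots_with_mult (\prod_(r <- s) ('X - r%:P)) s.
Proof.
move=> c; rewrite rmorph_prod -mup_prod_XsubC big_map.
by congr mup; apply: eq_bigr => r _; rewrite /= map_polyXsubC.
Qed.

Lemma sqr_eucl_dist (R : realType) (P Q : R * R) :
  eucl_dist P Q ^+ 2 = (P.1 - Q.1) ^+ 2 + (P.2 - Q.2) ^+ 2.
Proof. by rewrite sqr_sqrtr // addr_ge0 ?sqr_ge0. Qed.

(** Opposite roots pair up: (X - a)(X + a) = X^2 - a^2. *)
Lemma prod_XsubC_biquadratic (R : comNzRingType) (a b : R) :
  \prod_(r <- [:: a; b; - a; - b]) ('X - r%:P)
  = 'X^4 - (a ^+ 2 + b ^+ 2) *: 'X^2 + ((a * b) ^+ 2)%:P.
Proof.
(* Pushing [%:P] down to [a] and [b] leaves an identity for [ring]. *)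
rewrite !big_cons big_nil -mul_polyC !(polyCN, polyCD, polyCM, rmorphXn) /=.
ring.
Qed.

Theorem theorem1p3 (R : realType) (x z : R) :
  let P := (x, z / 2) in
  let R1 := eucl_dist P (0, 1 / 2) in
  let R2 := eucl_dist P (0, - (1 / 2)) in
  roots_with_mult (quartic x z)
    [:: R1 + R2; R1 - R2; - (R1 + R2); - (R1 - R2)].
Proof.
move=> P R1 R2.
have sqR1 : R1 ^+ 2 = x ^+ 2 + (z / 2 - 1 / 2) ^+ 2.
  by rewrite sqr_eucl_dist /= subr0.
have sqR2 : R2 ^+ 2 = x ^+ 2 + (z / 2 + 1 / 2) ^+ 2.
  by rewrite sqr_eucl_dist /= subr0 opprK.
have sum_sq : (R1 + R2) ^+ 2 + (R1 - R2) ^+ 2 = z ^+ 2 + 4 * x ^+ 2 + 1.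
  transitivity (2 * (R1 ^+ 2 + R2 ^+ 2)); first by ring.
  by rewrite sqR1 sqR2; field.
have prodE : (R1 + R2) * (R1 - R2) = - z.
  transitivity (R1 ^+ 2 - R2 ^+ 2); first by ring.
  by rewrite sqR1 sqR2; field.
have -> : quartic x z =
    \prod_(r <- [:: R1 + R2; R1 - R2; - (R1 + R2); - (R1 - R2)]) ('X - r%:P).
  (* The product enters squared, which turns [- z] into [z ^+ 2]. *)
  by rewrite prod_XsubC_biquadratic sum_sq prodE sqrrN.
exact: roots_with_mult_prod_XsubC.
Qed.
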